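(* Let $k\in\mathbb Z_{>0}$ and $m_1,m_2\in\mathbb Z$. Then $$\begin{aligned}\Sigma(2^k,-2^k;m_1,m_2)=2^k\delta_{2|k}\Big(&\delta_{2^k|m_1}2^k+\delta_{2^k|m_2}2^k-\delta_{2^{k-1}|m_1}2^{k-1}\\&+\sum_{i=1}^{k-1}(-1)^ig(2^2,m_1,2^{k-i})g(2^2,m_2,2^i)+\sum_{i=1}^{k-1}\delta_{2^{i-1}|m_2}2^{i-1}g(2^2,m_1,2^{k-i})\Big).\end{aligned}$$
   Context: $\delta_P$ is $1$ if the statement $P$ holds and $0$ otherwise. $(\frac{\cdot}{\cdot})$ is the Kronecker symbol; for nonzero reals $(x,y)_{\mathbb R}=-1$ if $x,y<0$ and $1$ otherwise. $g(d,m,n)=\sum_{x\in(\mathbb Z/n\mathbb Z)^\times}(\frac{x}{d})e^{2\pi i mx/n}$; in particular $g(2^2,m,2^n)=\sum_{x\in(\mathbb Z/2^n\mathbb Z)^\times}e^{2\pi imx/2^n}$ for $n\ge1$. $\Gamma=\Gamma_1(4)$ is the group of $\gamma\in\mathrm{SL}(3,\mathbb Z)$ congruent mod $4$ to an upper triangular unipotent matrix, and $\Gamma_\infty$ is the group of upper triangular unipotent matrices in $\mathrm{SL}(3,\mathbb Z)$. The Plücker coordinates of a matrix with second row $(d,e,f)$ and third row $(g,h,i)$ are $(-g,-h,-i,-(dh-eg),di-fg,-(ei-fh))$; for $\gamma\in\Gamma$ they are written $(4A_1,4B_1,C_1,4A_2,4B_2,C_2)$ with integers $A_i,B_i,C_i$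 (they satisfy $A_1C_2+4B_1B_2+C_1A_2=0$, $\gcd(A_i,B_i,C_i)=1$, $C_i\equiv-1$ mod $4$, and such tuples parametrize $\Gamma_\infty\backslash\Gamma$). Splitting: $s:\Gamma\to\{\pm1\}$ is the function such that $\gamma\mapsto(\gamma,s(\gamma))$ is Miller's splitting homomorphism of $\Gamma$ into the double cover of $\mathrm{SL}(3,\mathbb R)$; it is left and right $\Gamma_\infty$-invariant and for $A_1,A_2\neq0$ it is determined as follows. If $A_1>0$ and $A_2/D$ is odd, with $D=\gcd(A_1,A_2)$, $D_1=\gcd(D,B_1)$, $D_2=D/D_1$, $\epsilon=(\frac{-1}{B_1/D_1})$, then $$s(\gamma)=\Big(\tfrac{\epsilon}{-A_1A_2}\Big)\Big(\tfrac{A_1/D}{A_2/D}\Big)\Big(\tfrac{B_1/D_1}{A_1/D}\Big)\Big(\tfrac{4B_2/D_2}{|A_2|/D}\Big)\Big(\tfrac{D_1}{C_1}\Big)\Big(\tfrac{D_2}{C_2}\Big);$$ the remaining cases follow from $s(S_3\gamma S_3)=s(\gamma)$ with $S_3=\mathrm{diag}(1,1,-1)$, and $s(w_\ell{}^\intercal\gamma^{-1}w_\ell^{-1})=(-A_1,-A_2)_{\mathbb R}s(\gamma)$ with $w_\ell=\begin{pmatrix}0&0&1\\0&-1&0\\1&0&0\end{pmatrix}$. (Conventions: $(\frac{0}{1})=(\frac{-1}{0})=1$.) Exponential sums: for nonzero integers $A_1,A_2$, $\mathbb S(A_1,A_2)$ is the set of $\gamma\in\Gamma$ with Plücker coordinates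 $(4A_1,*,*,4A_2,*,* )$, and $\Sigma(A_1,A_2;m_1,m_2)=\sum_{\gamma\in\Gamma_\infty\backslash\mathbb S(A_1,A_2)/\Gamma_\infty}s(\gamma)e^{2\pi i(m_1\frac{B_1}{A_1}+m_2\frac{B_2}{A_2})}$ for $m_1,m_2\in\mathbb Z$. *)

(* Defs.v *)
From HB Require Import structures.
From mathcomp Require Import all_boot all_order all_algebra.
From mathcomp Require Import complex.
From mathcomp Require Import all_classical all_reals all_analysis.

Set Implicit Arguments.
Unset Strict Implicit.
Unset Printing Implicit Defensive.

Import Order.TTheory GRing.Theory Num.Theory.

Local Open Scope classical_set_scope.
Local Open Scope ring_scope.

(* The symbol (a / p) for a prime p, including p = 2. *)
Definition prime_symbol (a : int) (p : nat) : int :=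
  if (p %| a)%Z then 0
  else if p == 2 then
    (if ((a %% 8)%Z == 1) || ((a %% 8)%Z == 7) then 1 else -1)
  else if [exists x : 'I_p, (x%:Z ^+ 2 == a %[mod p])%Z] then 1 else -1.

(* The Kronecker symbol (a / n); in particular (0 / 1) = (-1 / 0) = 1. *)
Definition kronecker (a n : int) : int :=
  if n == 0 then (`|a|%N == 1%N)%:R
  else (if (n < 0) && (a < 0) then -1 else 1)
       * \prod_(p <- primes `|n|%N) prime_symbol a p ^+ logn p `|n|%N.

(* The Hilbert symbol (x, y) over the reals, at nonzero integers. *)
Definition hilbert_real (x y : int) : int :=
  if (x < 0) && (y < 0) then -1 else 1.

Definition e2pi (R : realType) (x : R) : R[i] :=
  (cos (2 * pi * x) +i* sin (2 * pi * x))%C.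

(* g(d, m, n).  The units of Z/nZ are represented by the x in {0, ..., n-1}
   prime to n, so this is meaningful when (x / d) depends only on such an x
   modulo n, e.g. for d = 4 and n = 2 ^ j with j >= 1. *)
Definition gauss_sum (R : realType) (d m : int) (n : nat) : R[i] :=
  \sum_(x < n | coprime x n)
    (kronecker x d)%:~R * e2pi ((m * x)%:~R / n%:R : R).

Definition Gamma_inf : set 'M[int]_3 :=
  [set u | forall i j : 'I_3, (j <= i)%N -> u i j = (i == j)%:R].

Definition Gamma : set 'M[int]_3 :=
  [set M | \det M = 1 /\
    exists2 u, Gamma_inf u & forall i j, (M i j = u i j %[mod 4])%Z].

(* The Pluecker coordinates of M in Gamma are (4 A1, 4 B1, C1, 4 A2, 4 B2, C2);
   the divisions by 4 below are exact for such M. *)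
Definition plA1 (M : 'M[int]_3) : int := ((- M 2 0)%R %/ 4)%Z.
Definition plB1 (M : 'M[int]_3) : int := ((- M 2 1)%R %/ 4)%Z.
Definition plC1 (M : 'M[int]_3) : int := - M 2 2.
Definition plA2 (M : 'M[int]_3) : int :=
  ((- (M 1 0 * M 2 1 - M 1 1 * M 2 0))%R %/ 4)%Z.
Definition plB2 (M : 'M[int]_3) : int :=
  ((M 1 0 * M 2 2 - M 1 2 * M 2 0)%R %/ 4)%Z.
Definition plC2 (M : 'M[int]_3) : int :=
  - (M 1 1 * M 2 2 - M 1 2 * M 2 1).

(* Valid for A1 > 0 and A2 / D odd.  All divisions are exact; in the fourth
   symbol it is 4 B2, and not always B2, that is divisible by D2. *)
Definition splitting_formula (M : 'M[int]_3) : int :=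
  let A1 := plA1 M in let B1 := plB1 M in let C1 := plC1 M in
  let A2 := plA2 M in let B2 := plB2 M in let C2 := plC2 M in
  let D := gcdz A1 A2 in
  let D1 := gcdz D B1 in
  let D2 := (D %/ D1)%Z in
  let eps := kronecker (-1) (B1 %/ D1)%Z in
  kronecker eps (- A1 * A2)
  * kronecker (A1 %/ D)%Z (A2 %/ D)%Z
  * kronecker (B1 %/ D1)%Z (A1 %/ D)%Z
  * kronecker ((4 * B2) %/ D2)%Z (`|A2| %/ D)%Z
  * kronecker D1 C1
  * kronecker D2 C2.

Definition S3 : 'M[int]_3 := diag_mx (\row_(j < 3) (if j == 2 then -1 else 1)).

(* The antidiagonal matrix with antidiagonal (1, -1, 1). *)
Definition w_long : 'M[int]_3 :=
  \matrix_(i < 3, j < 3) (if (i + j == 2)%N then (-1) ^+ i else 0).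

Definition w_dual (M : 'M[int]_3) : 'M[int]_3 :=
  w_long *m (invmx M)^T *m invmx w_long.

(* Conjugation by S3 maps (A1, A2) to (- A1, - A2). *)
Definition splitting_A2odd (M : 'M[int]_3) : int :=
  if 0 < plA1 M then splitting_formula M
  else splitting_formula (S3 *m M *m S3).

(* The splitting s on the matrices M of Gamma with A1, A2 both nonzero (the
   values at other matrices are irrelevant).  If A2 / D is even then A1 / D is
   odd; as w_dual exchanges A1 and A2 up to sign, the first case then applies
   to w_dual M, and s (w_dual M) = (- A1, - A2)_R s M. *)
Definition splitting (M : 'M[int]_3) : int :=
  let A1 := plA1 M in let A2 := plA2 M in
  if ~~ (2 %| A2 %/ gcdz A1 A2)%Z then splitting_A2odd M
  else hilbert_real (- A1) (- A2) * splitting_A2odd (w_dual M).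

Definition S_set (A1 A2 : int) : set 'M[int]_3 :=
  [set M | [/\ Gamma M, plA1 M = A1 & plA2 M = A2]].

Definition double_coset (M : 'M[int]_3) : set 'M[int]_3 :=
  [set u *m M *m v | u in Gamma_inf & v in Gamma_inf].

Definition double_cosets (A1 A2 : int) : set (set 'M[int]_3) :=
  double_coset @` S_set A1 A2.

(* Sigma(A1, A2; m1, m2) for nonzero A1, A2.  There are finitely many double
   cosets and the summand is constant on each of them, so that it may be
   evaluated at the representative chosen by xget (the default 0 is not used,
   double cosets being nonempty). *)
Definition Sigma (R : realType) (A1 A2 m1 m2 : int) : R[i] :=
  \sum_(X \in double_cosets A1 A2)
    let M := xget 0 X in
    (splitting M)%:~R
    * e2pi (m1%:~R * ((plB1 M)%:~R / A1%:~R)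
            + m2%:~R * ((plB2 M)%:~R / A2%:~R) : R).

(* Main.v *)
(* The invariants B1 mod 2^k, B2 mod 2^k and c mod 2^k, where C1 = 4 c - 1,
   identify the double cosets with the triples such that 2^k divides B1 B2.
   With 2^j = gcd (2^k, B1) and t = B1 B2 / 2^k, the Pluecker relation gives
   C2 = 4 (c - t) - 1, and the splitting reduces to
   (2^j / C1) (2^(k - j) / C2) = (-1)^(k c + (k - j) t) by the second
   supplementary law (2 / C) = 1 iff C = 1, -1 mod 8.  The sum over c vanishes
   for odd k and is 2^k for even k, and then grouping the remaining sum by the
   2-adic valuation j of B1 splits it into Gauss sums in m1 times twisted
   geometric sums in m2. *)

Require Import Defs.
From HB Require Import structures.
From mathcomp Require Import all_boot all_order all_algebra.
From mathcomp Require Import complex.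
From mathcomp Require Import all_classical all_reals all_analysis.
From mathcomp Require Import cyclic finfield.
From mathcomp Require Import zify ring lra.

Set Implicit Arguments.
Unset Strict Implicit.
Unset Printing Implicit Defensive.

Import Order.TTheory GRing.Theory Num.Theory.

Local Open Scope ring_scope.

(** * The second supplementary law and the symbols (2^j / c) *)

(** For odd [n] this is the symbol (2 / n). Even [n] get -1 as well, which breaks multiplicativity
    there, hence the oddness hypotheses. *)
Definition chi8 (n : nat) : int := if (n %% 8 \in [:: 1; 7])%N then 1 else -1.

Lemma chi8M (m n : nat) : odd m -> odd n -> chi8 (m * n) = chi8 m * chi8 n.
Proof.
rewrite /chi8 !inE -(modnMm m n) => om on.
have := ltn_pmod m (isT : 0 < 8)%N; have := ltn_pmod n (isT : 0 < 8)%N.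
have : odd (m %% 8) by rewrite odd_mod.
have : odd (n %% 8) by rewrite odd_mod.
by move: (m %% 8)%N (n %% 8)%N => [|[|[|[|[|[|[|[|m']]]]]]]] [|[|[|[|[|[|[|[|n']]]]]]]].
Qed.

Lemma chi8X (m j : nat) : odd m -> chi8 (m ^ j) = chi8 m ^+ j.
Proof.
move=> om; elim: j => [//|j IH].
by rewrite expnS exprS chi8M ?IH // oddX om orbT.
Qed.

Lemma pred_prime_half (p : nat) : odd p -> p = (p./2).*2.+1.
Proof. by move=> op; rewrite -[LHS](odd_double_half p) op. Qed.

(* Both sides list the doubles of 1, ..., p./2 up to sign: 2i <= p./2 is kept,
   and 2i > p./2 is replaced by minus the odd number p - 2i. *)
Lemma prod_double_Fp (p : nat) : prime p -> odd p ->
  \prod_(i < p./2) ((i.+1).*2)%:R =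
  \prod_(i < p./2) ((-1) ^+ i.+1 * (i.+1)%:R) :> 'F_p.
Proof.
move=> pp op; set h := p./2.
have hp : p = h.*2.+1 by exact: pred_prime_half.
(* [f i] is the zero-based index of the double equal to i + 1 if that is even, and to p - (i + 1)
   otherwise. *)
pose f (i : nat) := if odd i then i./2 else (h - i./2.+1)%N.
have fh (i : 'I_h) : (f i < h)%N by rewrite /f; case: i => i ih /=; case: ifP; lia.
have finj : injective (fun i => Ordinal (fh i)).
  move=> [i ih] [j jh] [] /=; rewrite /f => e; apply: val_inj => /=.
  by move: e; case: ifP => oi; case: ifP => oj; lia.
rewrite (reindex_inj finj) /=; apply: eq_bigr => -[i ih] _ /=.
rewrite /f exprS -signr_odd; case: ifP => oi /=.
  by rewrite expr1 mulrN1 opprK mul1r; congr _%:R; lia.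
rewrite expr0 mulr1 mulN1r; apply/eqP; rewrite -subr_eq0 opprK -natrD.
have -> : ((h - i./2.+1).+1.*2 + i.+1 = p)%N by lia.
by rewrite pchar_Fp_0.
Qed.

(** Gauss's argument: both products in [prod_double_Fp] contain the factorial of [p./2], a unit
    modulo p; cancelling it leaves the power of 2 on one side and a sign on the other. *)
Lemma two_exp_half_Fp (p : nat) : prime p -> odd p ->
  2 ^+ p./2 = (chi8 p)%:~R :> 'F_p.
Proof.
move=> pp op; have := prod_double_Fp pp op.
under eq_bigr do rewrite -muln2 natrM mulrC.
rewrite !big_split /= prodr_const card_ord.
set P := \prod_(_ < _) _%:R.
have P0 : P != 0.
  apply/prodf_neq0 => -[i ih] _ /=; rewrite -(dvdn_pcharf (pchar_Fp pp)).
  by apply/negP => /dvdn_leq; lia.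
move/(mulIf P0) ->.
(* The sign is (-1)^(n(n+1)/2), of period 4 in n; at n = [p./2] this becomes a condition on p modulo
   8. *)
have -> n : \prod_(i < n) (-1) ^+ i.+1 = (if (n %% 4 \in [:: 0; 3])%N then 1 else -1) :> 'F_p.
  elim: n => [|n IH]; first by rewrite big_ord0.
  rewrite big_ord_recr IH /= !inE -signr_odd.
  have := ltn_pmod n (isT : 0 < 4)%N.
  have -> : (n.+1 %% 4 = (n %% 4).+1 %% 4)%N by lia.
  have -> : odd n.+1 = odd (n %% 4).+1 by lia.
  by move: (n %% 4)%N => [|[|[|[|?]]]] //= _; rewrite ?expr0 ?expr1 ?mulr1 ?mulrN1 ?opprK.
rewrite /chi8 !inE; have hp := pred_prime_half op.
have -> : ((p %% 8 == 1) || (p %% 8 == 7))%N = ((p./2 %% 4 == 0) || (p./2 %% 4 == 3))%N by lia.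
by case: ifP.
Qed.

(** The power squares to 1, so it is a sign. If it is 1, write a = z^i with z a primitive root: p -
    1 divides i (p - 1)/2, so i is even and a is a square. *)
Lemma euler_criterion (p : nat) (a : 'F_p) : prime p -> odd p -> a != 0 ->
  a ^+ p./2 = if `[< exists x, x ^+ 2 = a >] then 1 else -1.
Proof.
move=> pp op a0; have cF := card_Fp pp; have hp := pred_prime_half op.
have x1 (x : 'F_p) : x != 0 -> x ^+ p.-1 = 1.
  move=> x0; apply: (mulfI x0); rewrite -exprS prednK ?prime_gt0 // mulr1.
  by rewrite -{2}[x]expf_card cF.
have h0 : (0 < p.-1)%N by have := prime_gt1 pp; lia.
case: asboolP => [[x xa]|nsq].
  rewrite -xa -exprM; have -> : (2 * p./2 = p.-1)%N by lia.
  have x0 : x != 0 by apply: contra_neq a0 => x0; rewrite -xa x0 expr0n.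
  exact: x1.
have : (a ^+ p./2) ^+ 2 = 1.
  have e : (p./2 * 2 = p.-1)%N by lia.
  by rewrite -exprM e x1.
move/eqP; rewrite sqrf_eq1 => /orP[/eqP ah|/eqP //].
pose rs := [seq x <- enum 'F_p | x != 0].
have rsP : all p.-1.-unity_root rs.
  by apply/allP => x; rewrite mem_filter => /andP[x0 _]; rewrite unity_rootE x1.
have urs : uniq rs by rewrite filter_uniq ?enum_uniq.
have srs : (p.-1 <= size rs)%N.
  rewrite size_filter; have := count_predC (pred1 (0 : 'F_p)) (enum 'F_p).
  rewrite -cardE cF (count_uniq_mem 0 (enum_uniq _)) mem_enum inE => e.
  by rewrite -[X in (X.-1 <= _)%N]e.
have /hasP[z _ zP] := has_prim_root h0 rsP urs srs.
have [i ai] := prim_rootP zP (x1 a a0).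
have : (p.-1 %| i * p./2)%N by rewrite (prim_order_dvd zP) exprM -ai ah.
rewrite [X in (X %| _)%N](_ : _ = 2 * p./2)%N; last by lia.
rewrite dvdn_pmul2r; last by have := prime_gt1 pp; lia.
move=> /dvdnP[q iq]; case: nsq; exists (z ^+ q).
by rewrite -exprM ai iq.
Qed.

Lemma prime_symbol_Fp (p : nat) (a : int) : prime p -> odd p -> ~~ (p %| a)%Z ->
  (prime_symbol a p)%:~R = a%:~R ^+ p./2 :> 'F_p.
Proof.
move=> pp op pa; have pd (b : int) : (p %| b)%Z = (b%:~R == 0 :> 'F_p).
  by rewrite -(dvdz_pcharf (pchar_Fp pp)).
rewrite euler_criterion -?pd // /prime_symbol (negPf pa).
have -> : (p == 2) = false by apply: contraTF op => /eqP->.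
have -> : [exists x : 'I_p, (x%:Z ^+ 2 == a %[mod p])%Z] = `[< exists x : 'F_p, x ^+ 2 = a%:~R >].
  apply/existsP/asboolP => -[x].
    rewrite eqz_mod_dvd pd rmorphB rmorphXn /= subr_eq0 => /eqP xa.
    by exists x%:R.
  move=> xa; have xp : (x < p)%N by rewrite -{2}(Fp_cast pp) ltn_ord.
  exists (Ordinal xp); rewrite eqz_mod_dvd pd rmorphB rmorphXn /= subr_eq0.
  by rewrite -xa -[in eqbRHS](natr_Zp x).
by case: ifP.
Qed.

(** Two signs differ by at most 2 < p, so an equality of signs may be checked in ['F_p], where
    Euler's criterion applies. *)
Lemma sign_inj_Fp (p : nat) (a b : int) : prime p -> odd p ->
  `|a| = 1 -> `|b| = 1 -> a%:~R = b%:~R :> 'F_p -> a = b.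
Proof.
move=> pp op ha hb /eqP; rewrite -subr_eq0 -rmorphB /= -(dvdz_pcharf (pchar_Fp pp)).
move=> /dvdzP[q hq]; have p3 : (2 < p)%N by have := prime_gt1 pp; lia.
suff q0 : q = 0 by rewrite q0 in hq; lia.
have : `|q| * p%:Z <= 2 by rewrite -[p%:Z]gez0_abs // -normrM -hq; lia.
by nia.
Qed.

Lemma absz_chi8 n : `|chi8 n| = 1.
Proof. by rewrite /chi8; case: ifP. Qed.

Lemma abs_prime_symbol (a : int) (p : nat) : ~~ (p %| a)%Z -> `|prime_symbol a p| = 1.
Proof. by rewrite /prime_symbol => /negPf->; do !case: ifP. Qed.

Lemma prime_symbol_two_exp (p j : nat) : prime p -> odd p ->
  prime_symbol (2 ^+ j) p = chi8 p ^+ j.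
Proof.
move=> pp op.
have pN2 : ~~ (p %| 2 ^+ j)%Z.
  rewrite dvdzE abszX /=; apply/negP; rewrite Euclid_dvdX // => /andP[].
  by rewrite dvdn_prime2 // => /eqP p2; rewrite p2 in op.
apply: (sign_inj_Fp pp op); rewrite ?abs_prime_symbol //.
  by rewrite normrX absz_chi8 expr1n.
rewrite prime_symbol_Fp // !rmorphXn /= -two_exp_half_Fp //.
by rewrite -!exprM mulnC.
Qed.

(** As 2^j > 0, the symbol depends on [|c|] only. Both sides are multiplicative over its prime
    factors; the induction carries oddness along because [chi8M] asks for it. *)
Lemma kronecker_two_exp (j : nat) (c : int) : odd `|c| ->
  kronecker (2 ^+ j) c = chi8 `|c| ^+ j.
Proof.
move=> oc; have c0 : (0 < `|c|)%N by case: `|c|%N oc.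
rewrite /kronecker; have -> : (c == 0) = false by apply: contraTF oc => /eqP->.
have -> : (2 ^+ j < 0 :> int) = false by apply/negbTE; rewrite -leNgt exprn_ge0.
rewrite andbF mul1r; set n := `|c|%N in oc c0 *.
have [_ <-] : odd (\prod_(p <- primes n) p ^ logn p n)%N /\
  chi8 (\prod_(p <- primes n) p ^ logn p n)%N ^+ j
    = \prod_(p <- primes n) prime_symbol (2 ^+ j) p ^+ logn p n.
  rewrite !big_seq; elim/big_ind2: _ => [|a x b y [oa ax] [ob bx]|p].
  - by rewrite /chi8 /= expr1n.
  - by rewrite oddM oa ob chi8M // exprMn ax bx.
  - rewrite mem_primes => /and3P[pp _ pn].
    have op : odd p by apply: dvdn_odd pn oc.
    by rewrite oddX op orbT chi8X // prime_symbol_two_exp // -!exprM mulnC.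
by rewrite [in RHS](prod_prime_decomp c0) prime_decompE big_map.
Qed.

(** * Exponential sums modulo powers of 2 *)

Section ExponentialSums.

Variable R : realType.

Local Notation e := (@e2pi R).

Lemma e2pi0 : e 0 = 1.
Proof. by rewrite /e2pi mulr0 cos0 sin0. Qed.

Lemma e2piD (x y : R) : e (x + y) = e x * e y.
Proof.
rewrite /e2pi mulrDr cosD sinD; apply/eqP; rewrite eq_complex /=.
by rewrite eqxx /= [X in _ == X]addrC; apply/eqP; ring.
Qed.

Lemma e2piMn (x : R) (n : nat) : e (x *+ n) = e x ^+ n.
Proof.
by elim: n => [|n IH]; rewrite ?mulr0n ?e2pi0 // mulrS exprS e2piD IH.
Qed.

Lemma e2pi_nat (n : nat) : e n%:R = 1.
Proof.
rewrite e2piMn /e2pi mulr1 mulr_natl cos2pi sin2pi.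
by rewrite -[(1 +i* 0)%C]/(1 : R[i]) expr1n.
Qed.

Lemma e2pi_int (m : int) : e m%:~R = 1.
Proof.
case: m => n; first exact: e2pi_nat.
rewrite NegzE rmorphN /=; set x := _%:~R.
have : e (- x + x) = 1 by rewrite addNr e2pi0.
by rewrite e2piD {2}/x e2pi_nat mulr1.
Qed.

Lemma e2pi_addz (x : R) (m : int) : e (x + m%:~R) = e x.
Proof. by rewrite e2piD e2pi_int mulr1. Qed.

(** The real part is 1 - 2 sin(pi x)^2, and the sine is positive on the open interval from 0 to
    pi. *)
Lemma e2pi_neq1 (x : R) : 0 < x < 1 -> e x != 1.
Proof.
move=> /andP[x0 x1]; apply/eqP => /(congr1 (@complex.Re R)) /= /eqP.
have -> : 2 * pi * x = (pi * x) *+ 2 by rewrite -mulr_natl; ring.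
rewrite cos_mulr2n cos2sin2.
have : 0 < sin (pi * x).
  apply: sin_gt0_pi; rewrite mulr_gt0 ?pi_gt0 //=.
  by rewrite gtr_pMr ?pi_gt0.
move=> s0; have : 0 < sin (pi * x) ^+ 2 by rewrite exprn_gt0.
by move: (sin _ ^+ 2) => y y0 /eqP; lra.
Qed.

Lemma e2pi_div_eq1 (m : int) (n : nat) : (0 < n)%N ->
  (e (m%:~R / n%:R) == 1) = (n %| m)%Z.
Proof.
move=> n0; have nR : n%:R != 0 :> R by rewrite pnatr_eq0 -lt0n.
have em : e (m%:~R / n%:R) = e ((m %% n)%Z%:~R / n%:R).
  rewrite {1}(divz_eq m n) intrD intrM mulrDl mulfK // addrC.
  by rewrite e2pi_addz.
apply/idP/idP => [|/dvdz_mod0P m0]; last by rewrite em m0 mul0r e2pi0.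
rewrite em; apply: contraLR => nm; apply: e2pi_neq1.
have m0 : (m %% n)%Z != 0 by apply: contraNneq nm => /dvdz_mod0P.
have n0z : n%:Z != 0 by lia.
have r0 := modz_ge0 m n0z; have rn := ltz_mod m n0z.
rewrite divr_gt0 ?ltr0n ?ltr_pdivrMr ?ltr0n ?mul1r //=.
  by rewrite -[n%:R]/(n%:~R) ltr_int; lia.
by rewrite ltr0z; lia.
Qed.

(** A geometric sum whose ratio z = e(m/n) satisfies z^n = 1. *)
Lemma sum_e2pi (m : int) (n : nat) : (0 < n)%N ->
  \sum_(y < n) e ((m * y)%:~R / n%:R) = (n %| m)%Z%:R * n%:R.
Proof.
move=> n0; have nR : n%:R != 0 :> R by rewrite pnatr_eq0 -lt0n.
under eq_bigr => y _ do rewrite intrM -mulrA [_ / _]mulrC mulrA mulr_natr e2piMn.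
have := e2pi_div_eq1 m n0; set z := e _ => <-.
case: eqP => [-> | /eqP z1].
  by under eq_bigr do rewrite expr1n; rewrite sumr_const card_ord mul1r.
rewrite mul0r; apply: (mulfI (_ : z - 1 != 0)); first by rewrite subr_eq0.
rewrite mulr0 -subrX1 /z -e2piMn -[X in e X]mulr_natr divfK //.
by rewrite e2pi_int subrr.
Qed.

Lemma coprime_pow2 (x n : nat) : coprime x (2 ^ n.+1) = odd x.
Proof. by rewrite coprime_pexpr // coprimen2. Qed.

Lemma sum_odd_even (V : nmodType) (n : nat) (F : nat -> V) :
  \sum_(x < n.*2) F x = \sum_(x < n.*2 | odd x) F x + \sum_(x < n) F x.*2.
Proof.
elim: n => [|n IH]; first by rewrite !big_ord0 addr0.
rewrite doubleS !big_ord_recr /= IH.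
rewrite [in RHS]big_mkcond 2!big_ord_recr -big_mkcond /= odd_double /= addr0.
by rewrite -!addrA; congr (_ + _); rewrite addrA addrC.
Qed.

(** The odd indices form the layer j = 0; halving the even ones leaves the same sum for k - 1. The
    index 0 survives every halving and stays apart. *)
Lemma sum_by_valuation (V : nmodType) (k : nat) (F : nat -> V) :
  \sum_(b < 2 ^ k) F b =
  F 0 + \sum_(j < k) \sum_(x < 2 ^ (k - j) | odd x) F (2 ^ j * x)%N.
Proof.
elim: k F => [|k IH] F; first by rewrite big_ord1 big_ord0 addr0.
rewrite expnS mul2n sum_odd_even (IH (fun x => F x.*2)) big_ord_recl /=.
rewrite addrCA subn0 expnS mul2n; congr (_ + (_ + _)).
  by apply: eq_bigr => x _; rewrite mul1n.
by apply: eq_bigr => j _; apply: eq_bigr => x _; rewrite expnS -mulnA mul2n.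
Qed.

Lemma sum_multiples (V : nmodType) (a b : nat) (F : nat -> V) : (0 < a)%N ->
  \sum_(y < a * b | (a %| y)%N) F y = \sum_(y < b) F (a * y)%N.
Proof.
move=> a0; rewrite -(big_mkord (fun y => a %| y)%N F) -(big_mkord xpredT (fun y => F (a * y)%N)).
rewrite -(big_map (muln a) xpredT F) -big_filter.
apply: perm_big; apply: uniq_perm.
- by rewrite filter_uniq // iota_uniq.
- by rewrite map_inj_uniq ?iota_uniq // => x y /eqP; rewrite eqn_pmul2l // => /eqP.
move=> y; rewrite mem_filter mem_index_iota /=.
apply/andP/mapP => [[/dvdnP[q ->]] | [x]].
  by exists q; rewrite ?mem_index_iota 1?mulnC //= ?ltn_pmul2l // -(ltn_pmul2l a0) mulnC.
by rewrite mem_index_iota /= => xb ->; rewrite dvdn_mulr ?ltn_pmul2l.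
Qed.

Lemma gauss_sum_pow2 (m : int) (n : nat) :
  gauss_sum R (2 ^+ 2) m (2 ^ n.+1) =
  \sum_(x < 2 ^ n.+1 | odd x) e ((m * x)%:~R / (2 ^ n.+1)%:R).
Proof.
rewrite /gauss_sum; under eq_bigl do rewrite coprime_pow2.
apply: eq_bigr => x ox; rewrite [kronecker _ _](_ : _ = 1) ?mul1r //.
rewrite /kronecker /= big_cons big_nil /= mulr1 /prime_symbol /=.
have -> : (2 %| x%:Z)%Z = false by lia.
by case: ifP => _; rewrite ?expr1n // ?mul1r ?sqrrN ?expr1n.
Qed.

(** A Ramanujan sum: the full sum modulo 2^(n+1) minus its even terms, which make up the full sum
    modulo 2^n. *)
Lemma gauss_sum_pow2E (m : int) (n : nat) :
  gauss_sum R (2 ^+ 2) m (2 ^ n.+1) =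
  (2 ^+ n.+1 %| m)%Z%:R * 2 ^+ n.+1 - (2 ^+ n %| m)%Z%:R * 2 ^+ n.
Proof.
have pz i : 2 ^+ i = (2 ^ i)%N%:Z by rewrite -natz natrX.
have pc i : 2 ^+ i = (2 ^ i)%N%:R :> R[i] by rewrite natrX.
rewrite gauss_sum_pow2 !pz !pc -!sum_e2pi ?expn_gt0 //.
have := sum_odd_even (2 ^ n) (fun x => e ((m * x)%:~R / (2 ^ n.+1)%:R)).
rewrite -mul2n -expnS => ->; apply/eqP; rewrite eq_sym subr_eq; apply/eqP; congr (_ + _).
apply: eq_bigr => y _; congr e; rewrite expnS -mul2n !PoszM !intrM natrM.
by rewrite mulrCA [X in X / _]mulrCA invfM !mulrA; field; rewrite ?pnatr_eq0 ?expn_eq0.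
Qed.

(** Since -1 = e(1/2), the twist only shifts the frequency, and the left side is again a full
    geometric sum. The right side is this value rewritten through the Gauss sum. *)
Lemma sum_twisted (m : int) (i : nat) : (0 < i)%N ->
  \sum_(y < 2 ^ i) (-1) ^+ (i * y) * e ((m * y)%:~R / (- (2 ^ i)%:R)) =
  (-1) ^+ i * gauss_sum R (2 ^+ 2) m (2 ^ i) + (2 ^+ i.-1 %| m)%Z%:R * 2 ^+ i.-1.
Proof.
case: i => // i _; rewrite gauss_sum_pow2E /=.
have pz j : 2 ^+ j = (2 ^ j)%N%:Z by rewrite -natz natrX.
have pc j : 2 ^+ j = (2 ^ j)%N%:R :> R[i] by rewrite natrX.
(* The shifted frequency: (i+1) y / 2 = (i+1) 2^i y / 2^(i+1), and the minus sign of the denominator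
   moves to m. *)
pose m' := - m + (i.+1 * 2 ^ i)%N%:Z.
have em (y : nat) : (-1) ^+ (i.+1 * y) * e ((m * y)%:~R / (- (2 ^ i.+1)%:R)) =
   e ((m' * y)%:~R / (2 ^ i.+1)%:R).
  have -> : (m' * y)%:~R / (2 ^ i.+1)%:R =
     (m * y)%:~R / (- (2 ^ i.+1)%:R) + 2^-1 *+ (i.+1 * y)%N :> R.
    rewrite /m' -[2^-1 *+ _]mulr_natr expnS !PoszM !(rmorphM, rmorphD, rmorphN) /=.
    rewrite -!pmulrn -[i.+1%:R]natr1; field.
    by rewrite -natrD pnatr_eq0 addn_eq0 expn_eq0.
  rewrite e2piD mulrC e2piMn; congr (_ * _ ^+ _).
  rewrite /e2pi mulrAC mulfV ?pnatr_eq0 // mul1r cospi sinpi.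
  by apply/eqP; rewrite eq_complex /= oppr0 !eqxx.
under eq_bigr do rewrite em.
rewrite sum_e2pi ?expn_gt0 // !pz !pc expnS.
have d0 : (2 ^ i)%N%:Z != 0 by rewrite eqz_nat expn_eq0.
have [/dvdzP[q mq]|d] := boolP ((2 ^ i)%N%:Z %| m)%Z; last first.
  have -> : ((2 * 2 ^ i)%N %| m)%Z = false.
    by apply: contraNF d; apply: dvdz_trans; rewrite PoszM dvdz_mull.
  have -> : ((2 * 2 ^ i)%N %| m')%Z = false.
    apply: contraNF d => d'; have : ((2 ^ i)%N %| m')%Z.
      by apply: dvdz_trans d'; rewrite PoszM dvdz_mull.
    by rewrite /m' rpredDr ?rpredN // PoszM dvdz_mull.
  by rewrite !mul0r subrr mulr0 addr0.
have -> : m' = (i.+1%:Z - q) * (2 ^ i)%N by rewrite /m' mq PoszM; ring.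
rewrite mq !PoszM !dvdz_mul2r // mul1r natrM -signr_odd.
(* Only the parities of i + 1 and q = m / 2^i are left to compare. *)
have -> : (2 %| i.+1%:Z - q)%Z = (odd i.+1 (+) (2 %| q)%Z) by lia.
by case: (odd i.+1); case: (2 %| q)%Z; rewrite /= ?expr0 ?expr1; ring.
Qed.

(** For a = 2^j x with x odd, the admissible b are the 2^(k-j) y with y < 2^j, and ab / 2^k = xy.
    The remaining sum over y does not involve x, so the sum over x can become a Gauss sum. *)
Lemma sum_fixed_odd_part (m1 m2 : int) (k j x : nat) :
  ~~ odd k -> (j < k)%N -> odd x ->
  \sum_(b < 2 ^ k | (2 ^ k %| 2 ^ j * x * b)%N)
     (-1) ^+ ((k - logn 2 (gcdn (2 ^ k) (2 ^ j * x))) * (2 ^ j * x * b %/ 2 ^ k))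
     * e (m1%:~R * ((2 ^ j * x)%:R / 2 ^+ k) + m2%:~R * (b%:R / - 2 ^+ k)) =
  e ((m1 * x)%:~R / (2 ^ (k - j))%:R) *
  \sum_(y < 2 ^ j) (-1) ^+ (j * y) * e ((m2 * y)%:~R / (- (2 ^ j)%:R)).
Proof.
move=> ek jk ox; have ekj : (2 ^ k = 2 ^ j * 2 ^ (k - j))%N.
  by rewrite -expnD subnKC // ltnW.
have -> : gcdn (2 ^ k) (2 ^ j * x) = (2 ^ j)%N.
  rewrite ekj -muln_gcdr; have /eqP -> : coprime (2 ^ (k - j)) x; last exact: muln1.
  by rewrite coprimeXl // coprime2n.
rewrite pfactorK //.
have dvdE (b : nat) : (2 ^ k %| 2 ^ j * x * b)%N = (2 ^ (k - j) %| b)%N.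
  rewrite ekj -mulnA dvdn_pmul2l ?expn_gt0 // Gauss_dvdr //.
  by rewrite coprimeXl // coprime2n.
rewrite (eq_bigl _ _ (fun b : 'I__ => dvdE b)).
have a0 : (0 < 2 ^ (k - j))%N by rewrite expn_gt0.
have := sum_multiples (2 ^ j)%N (fun b : nat =>
     (-1) ^+ ((k - j) * (2 ^ j * x * b %/ 2 ^ k))%N
     * e (m1%:~R * ((2 ^ j * x)%:R / 2 ^+ k) + m2%:~R * (b%:R / - 2 ^+ k)))
  a0.
rewrite mulnC -ekj => ->.
rewrite mulr_sumr; apply: eq_bigr => y _.
have -> : (2 ^ j * x * (2 ^ (k - j) * y) %/ 2 ^ k = x * y)%N.
  by rewrite mulnACA -ekj mulKn // expn_gt0.
(* k is even and x is odd. *)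
have -> : (-1) ^+ ((k - j) * (x * y)) = (-1) ^+ (j * y) :> R[i].
  by rewrite -signr_odd -[RHS]signr_odd !oddM oddB ?(ltnW jk) // (negPf ek) ox.
rewrite e2piD mulrCA. congr (e2pi _ * (_ * e2pi _)).
all: rewrite -natrX ekj ?natrM !intrM -?pmulrn; field.
all: by rewrite ?pnatr_eq0 ?expn_eq0.
Qed.

Lemma sum_double_cosets (m1 m2 : int) (k : nat) : (0 < k)%N -> ~~ odd k ->
  \sum_(a < 2 ^ k) \sum_(b < 2 ^ k | (2 ^ k %| a * b)%N)
     (-1) ^+ ((k - logn 2 (gcdn (2 ^ k) a)) * (a * b %/ 2 ^ k))
     * e (m1%:~R * (a%:R / 2 ^+ k) + m2%:~R * (b%:R / - 2 ^+ k)) =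
  (2 ^+ k %| m1)%Z%:R * 2 ^+ k
   + (2 ^+ k %| m2)%Z%:R * 2 ^+ k
   - (2 ^+ k.-1 %| m1)%Z%:R * 2 ^+ k.-1
   + \sum_(1 <= i < k)
       (-1) ^+ i * gauss_sum R (2 ^+ 2) m1 (2 ^ (k - i))
         * gauss_sum R (2 ^+ 2) m2 (2 ^ i)
   + \sum_(1 <= i < k)
       (2 ^+ i.-1 %| m2)%Z%:R * 2 ^+ i.-1
         * gauss_sum R (2 ^+ 2) m1 (2 ^ (k - i)).
Proof.
move=> k0 ek.
rewrite (sum_by_valuation k (fun a => \sum_(b < 2 ^ k | (2 ^ k %| a * b)%N)
     (-1) ^+ ((k - logn 2 (gcdn (2 ^ k) a)) * (a * b %/ 2 ^ k))
     * e (m1%:~R * (a%:R / 2 ^+ k) + m2%:~R * (b%:R / - 2 ^+ k)))).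
(* For a = 0 every b is admissible and the sign is 1, which gives the full sum in m2. *)
rewrite [X in X + _](_ : _ = (2 ^+ k %| m2)%Z%:R * 2 ^+ k); last first.
  have pz : 2 ^+ k = (2 ^ k)%N%:Z by rewrite -natz natrX.
  have pc : 2 ^+ k = (2 ^ k)%N%:R :> R[i] by rewrite natrX.
  have -> : (2 ^+ k %| m2)%Z = (2 ^+ k %| - m2)%Z by rewrite !dvdzE abszN.
  rewrite pz pc -sum_e2pi ?expn_gt0 //.
  apply: eq_big => [b | b _]; first by rewrite mul0n dvdn0.
  rewrite mul0n div0n muln0 expr0 mul1r; congr e2pi.
  rewrite mul0r mulr0 add0r intrM -natrX rmorphN invrN !mulrN !mulNr.
  by rewrite mulrA.
have gauss_factor j : (j < k)%N ->
  \sum_(x < 2 ^ (k - j) | odd x) \sum_(b < 2 ^ k | (2 ^ k %| 2 ^ j * x * b)%N)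
     (-1) ^+ ((k - logn 2 (gcdn (2 ^ k) (2 ^ j * x))) * (2 ^ j * x * b %/ 2 ^ k))
     * e (m1%:~R * ((2 ^ j * x)%:R / 2 ^+ k) + m2%:~R * (b%:R / - 2 ^+ k)) =
  gauss_sum R (2 ^+ 2) m1 (2 ^ (k - j)) *
  \sum_(y < 2 ^ j) (-1) ^+ (j * y) * e ((m2 * y)%:~R / (- (2 ^ j)%:R)).
  move=> jk; have -> : (k - j = (k - j).-1.+1)%N by lia.
  rewrite gauss_sum_pow2 mulr_suml prednK ?subn_gt0 //.
  by apply: eq_bigr => x ox; rewrite sum_fixed_odd_part.
under eq_bigr => j _ do rewrite gauss_factor //.
rewrite -(big_mkord xpredT (fun j => gauss_sum R (2 ^+ 2) m1 (2 ^ (k - j)) *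
  \sum_(y < 2 ^ j) (-1) ^+ (j * y) * e ((m2 * y)%:~R / (- (2 ^ j)%:R)))).
(* For j = 0 the inner sum is the single term 1, and the closed form of the Gauss sum modulo 2^k
   yields the two terms in m1. The layers j >= 1 use [sum_twisted]. *)
rewrite big_ltn // subn0 big_ord1 /= mul0n expr0 mulr0 mul0r e2pi0 !mulr1.
have := gauss_sum_pow2E m1 k.-1; rewrite prednK // => ->.
rewrite -[RHS]addrA -big_split /= addrA.
congr (_ + _); first by rewrite addrCA addrA.
apply: eq_big_nat => i /andP[i0 ik].
by rewrite sum_twisted // mulrDr mulrA [X in X * _ + _]mulrC [X in _ + X]mulrC.
Qed.

End ExponentialSums.

(** * The groups of 3 by 3 matrices and Plücker coordinates *)

Section Matrices3.

Lemma ord3P (P : 'I_3 -> Prop) : P 0 -> P 1 -> P 2 -> forall i, P i.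
Proof.
move=> p0 p1 p2 [[|[|[|//]]] ih]; [have <- : 0 = Ordinal ih by apply: val_inj
  | have <- : 1 = Ordinal ih by apply: val_inj
  | have <- : 2 = Ordinal ih by apply: val_inj]; by [].
Qed.

Lemma sum_ord3 (V : nmodType) (F : 'I_3 -> V) : \sum_i F i = F 0 + F 1 + F 2.
Proof.
rewrite !big_ord_recl big_ord0 addr0 addrA.
by congr (F _ + F _ + F _); apply: val_inj.
Qed.

Lemma mulmx3E (R : pzSemiRingType) (M N : 'M[R]_3) i j :
  (M *m N) i j = M i 0 * N 0 j + M i 1 * N 1 j + M i 2 * N 2 j.
Proof. by rewrite mxE sum_ord3. Qed.

Definition mx3 (R : nzRingType) (s : seq (seq R)) : 'M[R]_3 :=
  \matrix_(i < 3, j < 3) nth 0 (nth [::] s i) j.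

Lemma cofactor3_0 (R : comNzRingType) (M : 'M[R]_3) :
  [/\ cofactor M 0 0 = M 1 1 * M 2 2 - M 1 2 * M 2 1,
      cofactor M 0 1 = M 1 2 * M 2 0 - M 1 0 * M 2 2
    & cofactor M 0 2 = M 1 0 * M 2 1 - M 1 1 * M 2 0].
Proof.
have d2 (A : 'M[R]_2) : \det A = A 0 0 * A 1 1 - A 0 1 * A 1 0.
  (* Indexing by natural numbers lets simplification identify ordinals built in different ways, so
     that [ring] sees equal entries. *)
  pose a i j := A (inord i) (inord j).
  have aE i j : A i j = a i j by rewrite /a !inord_val.
  rewrite (expand_det_row A 0) !big_ord_recl big_ord0 /cofactor !det_mx11 !mxE.
  by rewrite !aE /= /bump /=; ring.
pose m i j := M (inord i) (inord j).
have mE i j : M i j = m i j by rewrite /m !inord_val.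
by split; rewrite /cofactor d2 !mxE !mE /= /bump /=; ring.
Qed.

Lemma det_mx33 (R : comNzRingType) (M : 'M[R]_3) :
  \det M = M 0 0 * (M 1 1 * M 2 2 - M 1 2 * M 2 1)
         + M 0 1 * (M 1 2 * M 2 0 - M 1 0 * M 2 2)
         + M 0 2 * (M 1 0 * M 2 1 - M 1 1 * M 2 0).
Proof.
by rewrite (expand_det_row M 0) sum_ord3; have [-> -> ->] := cofactor3_0 M.
Qed.

Definition unip (x y z : int) : 'M[int]_3 :=
  mx3 [:: [:: 1; x; z]; [:: 0; 1; y]; [:: 0; 0; 1]].

Lemma Gamma_infP (u : 'M[int]_3) :
  Gamma_inf u <-> exists x y z, u = unip x y z.
Proof.
split=> [h | [x [y [z ->]]]]; last first.
  by elim/ord3P => [] /=; elim/ord3P; rewrite // /unip mxE.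
exists (u 0 1), (u 1 2), (u 0 2); apply/matrixP.
by elim/ord3P; elim/ord3P; rewrite mxE //= ?h.
Qed.

Lemma unipM x y z x' y' z' :
  unip x y z *m unip x' y' z' = unip (x + x') (y + y') (z + z' + x * y').
Proof.
apply/matrixP; elim/ord3P; elim/ord3P; rewrite mulmx3E !mxE /=; ring.
Qed.

Lemma unip0 : unip 0 0 0 = 1%:M.
Proof. by apply/matrixP; elim/ord3P; elim/ord3P; rewrite !mxE. Qed.

Lemma Gamma_infM u v : Gamma_inf u -> Gamma_inf v -> Gamma_inf (u *m v).
Proof.
move=> /Gamma_infP[x [y [z ->]]] /Gamma_infP[x' [y' [z' ->]]].
by apply/Gamma_infP; rewrite unipM; do 3!eexists.
Qed.

Lemma Gamma_inf1 : Gamma_inf 1%:M.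
Proof. by apply/Gamma_infP; exists 0, 0, 0; rewrite unip0. Qed.

Lemma Gamma_infV u : Gamma_inf u ->
  exists2 u', Gamma_inf u' & u' *m u = 1%:M /\ u *m u' = 1%:M.
Proof.
move=> /Gamma_infP[x [y [z ->]]]; exists (unip (- x) (- y) (x * y - z)).
  by apply/Gamma_infP; do 3!eexists.
by rewrite !unipM -unip0; split; congr unip; ring.
Qed.

Lemma det_Gamma_inf u : Gamma_inf u -> \det u = 1.
Proof. by move=> /Gamma_infP[x [y [z ->]]]; rewrite det_mx33 !mxE /=; ring. Qed.

(** Entries above the diagonal are unconstrained: the unipotent witness may copy them from [M]. *)
Lemma GammaP (M : 'M[int]_3) :
  Gamma M <-> \det M = 1 /\
    forall i j : 'I_3, (j <= i)%N -> (4 %| M i j - (i == j)%:R)%Z.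
Proof.
split=> [[dM [u hu Mu]] | [dM h]]; split=> //.
  by move=> i j ji; rewrite -eqz_mod_dvd Mu hu.
exists (\matrix_(i, j) if (j <= i)%N then (i == j)%:R else M i j).
  by move=> i j ji; rewrite mxE ji.
by move=> i j; rewrite mxE; case: ifP => // ji; apply/eqP; rewrite eqz_mod_dvd h.
Qed.

Lemma GammaM (M N : 'M[int]_3) : Gamma M -> Gamma N -> Gamma (M *m N).
Proof.
move=> /GammaP[dM hM] /GammaP[dN hN]; apply/GammaP.
rewrite det_mulmx dM dN mulr1; split=> // i j ji.
have -> : (i == j)%:R = \sum_l ((i == l) && (l == j))%:R :> int.
  rewrite (bigD1 i) //= eqxx /= big1 ?addr0 // => l /negPf.
  by rewrite eq_sym => ->.
rewrite mxE -sumrB; apply: rpred_sum => l _.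
(* Modulo 4 the factor [M i l] vanishes for l < i, and [N l j] vanishes for l > i since then l > j;
   only l = i contributes. *)
case: (ltngtP l i) => li.
- have := hM i l (ltnW li); have -> : (i == l) = false by apply/eqP => il; rewrite il ltnn in li.
  by rewrite /= !subr0; apply: dvdz_mulr.
- have lj : (j <= l)%N by apply: leq_trans ji (ltnW li).
  have := hN l j lj; have -> : (l == j) = false.
    by apply/eqP => lj'; move: li; rewrite lj' ltnNge ji.
  by rewrite andbF /= !subr0; apply: dvdz_mull.
- have {li} -> : l = i by apply: val_inj.
  have h1 := hM i i (leqnn _); have h2 := hN i j ji; rewrite eqxx /= in h1 *.
  have -> : M i i * N i j - (i == j)%:R =
    (M i i - 1) * N i j + (N i j - (i == j)%:R) by ring.
  by rewrite rpredD // dvdz_mulr.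
Qed.

Lemma Gamma_inf_sub u : Gamma_inf u -> Gamma u.
Proof. by move=> hu; split; [exact: det_Gamma_inf | exists u]. Qed.

(** Equations without the divisions by 4 of [plA1] and the like, hence suited to [ring]. The last
    three list the cofactors of the first row, from right to left. *)
Record plucker (M : 'M[int]_3) (A1 B1 C1 A2 B2 C2 : int) : Prop := Plucker {
  pl20 : M 2 0 = - (4 * A1);
  pl21 : M 2 1 = - (4 * B1);
  pl22 : M 2 2 = - C1;
  plm2 : M 1 0 * M 2 1 - M 1 1 * M 2 0 = - (4 * A2);
  plm1 : M 1 2 * M 2 0 - M 1 0 * M 2 2 = - (4 * B2);
  plm0 : M 1 1 * M 2 2 - M 1 2 * M 2 1 = - C2 }.

Lemma Gamma_plucker M : Gamma M ->
  plucker M (plA1 M) (plB1 M) (plC1 M) (plA2 M) (plB2 M) (plC2 M).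
Proof.
move=> /GammaP[_ h].
have /dvdzP[a ha] := h 2 0 isT; have /dvdzP[b hb] := h 2 1 isT.
have /dvdzP[c hc] := h 1 0 isT; rewrite !subr0 in ha hb hc.
rewrite /plA1 /plB1 /plA2 /plB2 /plC1 /plC2; split; rewrite ?opprK //.
- by rewrite ha -[X in (X %/ 4)%Z]mulNr mulzK // mulrN opprK mulrC.
- by rewrite hb -[X in (X %/ 4)%Z]mulNr mulzK // mulrN opprK mulrC.
- rewrite ha hb hc [X in (X %/ 4)%Z](_ : _ = (M 1 1 * a - c * (b * 4)) * 4); last by ring.
  by rewrite mulzK //; ring.
- rewrite ha hc [X in (X %/ 4)%Z](_ : _ = (c * M 2 2 - M 1 2 * a) * 4); last by ring.
  by rewrite mulzK //; ring.
Qed.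

Lemma pluckerE M A1 B1 C1 A2 B2 C2 : plucker M A1 B1 C1 A2 B2 C2 ->
  [/\ plA1 M = A1, plB1 M = B1 & plC1 M = C1] /\
  [/\ plA2 M = A2, plB2 M = B2 & plC2 M = C2].
Proof.
case=> h0 h1 h2 h3 h4 h5; rewrite /plA1 /plB1 /plC1 /plA2 /plB2 /plC2.
have -> : M 1 0 * M 2 2 - M 1 2 * M 2 0 = 4 * B2 by rewrite -[RHS]opprK -h4 opprB.
rewrite h3 h5 h0 h1 h2 !opprK.
by rewrite !mulKz.
Qed.

(** The third row is orthogonal to the cofactors of the first row. *)
Lemma plucker_relation M A1 B1 C1 A2 B2 C2 : plucker M A1 B1 C1 A2 B2 C2 ->
  A1 * C2 + 4 * B1 * B2 + C1 * A2 = 0.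
Proof.
case=> h0 h1 h2 h3 h4 h5.
have : M 2 0 * (M 1 1 * M 2 2 - M 1 2 * M 2 1)
     + M 2 1 * (M 1 2 * M 2 0 - M 1 0 * M 2 2)
     + M 2 2 * (M 1 0 * M 2 1 - M 1 1 * M 2 0) = 0 by ring.
rewrite h3 h4 h5 h0 h1 h2 => h; lia.
Qed.

Lemma plucker_left u M A1 B1 C1 A2 B2 C2 : Gamma_inf u ->
  plucker M A1 B1 C1 A2 B2 C2 -> plucker (u *m M) A1 B1 C1 A2 B2 C2.
Proof.
move=> /Gamma_infP[x [y [z ->]]] [h0 h1 h2 h3 h4 h5].
split; rewrite !mulmx3E !mxE /= ?(mul0r, add0r, mul1r) //;
  rewrite -?h3 -?h4 -?h5; ring.
Qed.

(** Shows what right multiplication can normalise: x moves B1 modulo A1, y moves B2 modulo A2, and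
    then z moves C1 modulo 4 A1. *)
Lemma plucker_right M A1 B1 C1 A2 B2 C2 x y z :
  plucker M A1 B1 C1 A2 B2 C2 ->
  plucker (M *m unip x y z) A1 (B1 + x * A1) (C1 + 4 * (z * A1 + y * B1))
    A2 (B2 - y * A2) (C2 - 4 * (z - x * y) * A2 - 4 * x * B2).
Proof.
move=> [h0 h1 h2 h3 h4 h5]; split; rewrite !mulmx3E !mxE /=.
- by rewrite h0; ring.
- by rewrite h0 h1; ring.
- by rewrite h0 h1 h2; ring.
- by rewrite -h3; ring.
- rewrite (_ : - (4 * (B2 - y * A2)) = - (4 * B2) - y * - (4 * A2)); last by ring.
  by rewrite -h3 -h4; ring.
- rewrite (_ : - (_ - _ - _) = - C2 + (x * y - z) * - (4 * A2) - x * - (4 * B2)); last by ring.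
  by rewrite -h3 -h4 -h5; ring.
Qed.

(* With w the first column of the adjugate, the two matrices share w and the
   third row, which makes the quotient unitriangular. *)
Lemma plucker_inj M M' A1 B1 C1 A2 B2 C2 : \det M = 1 -> \det M' = 1 ->
  plucker M A1 B1 C1 A2 B2 C2 -> plucker M' A1 B1 C1 A2 B2 C2 ->
  exists2 u, Gamma_inf u & M' = u *m M.
Proof.
move=> dM dM' [h0 h1 h2 h3 h4 h5] [h0' h1' h2' h3' h4' h5'].
have [u uE] : exists u, u = M' *m \adj M by exists (M' *m \adj M).
exists u; last first.
  by rewrite uE -mulmxA mul_adj_mx dM mulmx1.
have du : \det u = 1.
  have : \det (u *m M) = 1 by rewrite uE -mulmxA mul_adj_mx dM mulmx1.
  by rewrite det_mulmx dM mulr1.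
have u_col : forall i, u i 0 = (i == 0)%:R.
  move=> i; have := congr1 (fun A : 'M[int]_3 => A i 0) (mul_mx_adj M').
  rewrite /= dM' uE !mulmx3E !mxE => <-.
  have [-> -> ->] := cofactor3_0 M; have [-> -> ->] := cofactor3_0 M'.
  by rewrite h3 h4 h5 h3' h4' h5'.
have u_row : forall j, u 2 j = (2 == j)%:R.
  move=> j; have := congr1 (fun A : 'M[int]_3 => A 2 j) (mul_mx_adj M).
  rewrite /= dM uE !mulmx3E !mxE => <-.
  by rewrite h0 h1 h2 h0' h1' h2'.
(* With the first column and last row known, the determinant of [u] is this entry. *)
have u11 : u 1 1 = 1.
  move: du; rewrite det_mx33 !u_col !u_row /= => <-; ring.
elim/ord3P => //; elim/ord3P => //= _; rewrite ?u_col ?u_row ?u11 //.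
Qed.

End Matrices3.

(** * The splitting at A1 = 2^k, A2 = -2^k *)

Lemma kronecker_m1_abs (b : int) : `|kronecker (-1) b| = 1.
Proof.
rewrite /kronecker; case: ifP => [//|_]; rewrite normrM.
have -> : `|if (b < 0) && (-1 < 0 :> int) then -1 else 1 : int| = 1 by case: ifP.
rewrite mul1r normr_prod big_seq big1 // => p; rewrite mem_primes => /and3P[pp _ _].
rewrite normrX abs_prime_symbol ?expr1n // dvdzE /=.
by rewrite dvdn1; case: eqP pp => // ->.
Qed.

(** Both 1 and -1 have symbol 1 at the prime 2. This removes the factor of the splitting that
    involves [eps], whose denominator is 2^(2k). *)
Lemma kronecker_unit_pow2 (a : int) (n : nat) : `|a| = 1 -> kronecker a (2 ^+ n) = 1.
Proof.
move=> ha; rewrite /kronecker.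
have n0 : 0 < 2 ^+ n :> int by rewrite exprn_gt0.
rewrite (gt_eqF n0) (lt_gtF n0) mul1r big_seq big1 // => p.
rewrite mem_primes abszX /= => /and3P[pp _].
rewrite Euclid_dvdX // => /andP[]; rewrite dvdn_prime2 // => /eqP -> _.
have /orP[/eqP->|/eqP->] : (a == 1) || (a == -1) by lia.
all: by rewrite /prime_symbol /= expr1n.
Qed.

Lemma kronecker_n1 (a : int) : kronecker a 1 = 1.
Proof. by rewrite /kronecker /= big_nil mulr1. Qed.

Lemma kronecker_1N1 : kronecker 1 (-1) = 1.
Proof. by rewrite /kronecker /= big_nil mulr1. Qed.

Lemma chi8_plucker (c : int) : chi8 `|(4 * c - 1)%R| = (-1) ^+ `|c|%N.
Proof.
rewrite /chi8 !inE -signr_odd.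
have -> : ((`|(4 * c - 1)%R| %% 8 == 1) || (`|(4 * c - 1)%R| %% 8 == 7))%N = ~~ odd `|c|.
  by lia.
by case: odd.
Qed.

Lemma gcdn_pow2 (k b : nat) :
  exists2 j, (j <= k)%N & gcdn (2 ^ k) b = (2 ^ j)%N.
Proof. by apply/(dvdn_pfactor _ _ (isT : prime 2)); exact: dvdn_gcdl. Qed.

(** A1 > 0 and A2 / D = -1 is odd, so the explicit formula applies directly. Its first four symbols
    are 1: they are (eps / 2^(2k)), (1 / -1) and two with denominator 1. *)
Lemma splitting_pow2 (k : nat) (M : 'M[int]_3) (c t : int) :
  plA1 M = 2 ^+ k -> plA2 M = - 2 ^+ k -> plC1 M = 4 * c - 1 ->
  plC2 M = 4 * (c - t) - 1 ->
  splitting M =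
  (-1) ^+ (k * `|c| + (k - logn 2 (gcdn (2 ^ k) `|plB1 M|)) * `|t|)%N.
Proof.
move=> hA1 hA2 hC1 hC2; have k0 : 0 < 2 ^+ k :> int by rewrite exprn_gt0.
have gD : gcdz (2 ^+ k) (- 2 ^+ k) = 2 ^+ k.
  by rewrite /gcdz abszN gcdnn abszX -natz natrX.
have qD : (- 2 ^+ k %/ 2 ^+ k)%Z = -1 by rewrite -mulN1r mulzK // gt_eqF.
rewrite /splitting hA1 hA2 gD qD /= /splitting_A2odd hA1 k0 /splitting_formula.
rewrite hA1 hA2 gD qD hC1 hC2 normrN gtr0_norm // divzz gt_eqF //=.
have [j jk gj] := gcdn_pow2 k `|plB1 M|.
have -> : gcdz (2 ^+ k) (plB1 M) = 2 ^+ j.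
  by rewrite /gcdz abszX gj -natz natrX.
have -> : (2 ^+ k %/ 2 ^+ j)%Z = 2 ^+ (k - j).
  by rewrite -{1}(subnK jk) exprD mulzK // gt_eqF ?exprn_gt0.
rewrite gj pfactorK // mulrNN -exprD kronecker_unit_pow2 ?kronecker_m1_abs //.
rewrite kronecker_1N1 !kronecker_n1.
rewrite !mul1r !kronecker_two_exp; try by lia.
rewrite !chi8_plucker -!exprM -exprD -[LHS]signr_odd -[RHS]signr_odd.
congr (_ ^+ _); congr nat_of_bool; rewrite -{2}(subnKC jk).
move: (k - j)%N => r; rewrite !(oddD, oddM).
have -> : odd `|(c - t)%R| = odd `|c| (+) odd `|t| by lia.
by case: (odd j); case: (odd r); case: (odd `|c|); case: (odd `|t|).
Qed.

(** * Parametrization of the double cosets *)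

Lemma coprimez_bezout (a b : int) : coprimez a b ->
  exists u v, u * a + v * b = 1.
Proof. by move=> /eqP <-; have [u [v h]] := Bezoutz a b; exists u, v. Qed.

Lemma coprimez_four_pow2 (k : nat) (c : int) :
  coprimez (4 * 2 ^+ k) (4 * c - 1).
Proof.
rewrite (_ : 4 * 2 ^+ k = 2 ^+ (k + 2)); last by rewrite exprD mulrC.
by rewrite coprimezXl // coprimezE coprime2n; lia.
Qed.

(* The third row [r] is completed using an integral [q] with [q . r = 1]: the
   second row is the cross product of [q] and the vector [w] of minors, and the
   first row is any solution of [x . w = 1]. *)
Lemma plucker_exists (k : nat) (b1 b2 c t : int) : b1 * b2 = t * 2 ^+ k ->
  exists2 M, Gamma M & plucker M (2 ^+ k) b1 (4 * c - 1)
                         (- 2 ^+ k) b2 (4 * (c - t) - 1).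
Proof.
move=> bt; set N : int := 2 ^+ k in bt *.
(* The outer entries of [r], and those of [w], are already coprime, so middle entries 0 suffice: q =
   (-q0, 0, -q2) and x = (-r2, 0, r0). *)
have [q0 [q2 hq]] := coprimez_bezout (coprimez_four_pow2 k c).
have [r0 [r2 hr]] := coprimez_bezout (coprimez_four_pow2 k (c - t)).
rewrite -/N in hq hr.
pose M : 'M[int]_3 := mx3 [:: [:: - r2; 0; r0];
  [:: - (4 * q2 * b2); q2 * (4 * (c - t) - 1) + 4 * N * q0; 4 * q0 * b2];
  [:: - (4 * N); - (4 * b1); 1 - 4 * c]].
have hp : plucker M N b1 (4 * c - 1) (- N) b2 (4 * (c - t) - 1).
  split; rewrite !mxE //=.
  - ring.
  - transitivity (4 * N * (q0 * (4 * N) + q2 * (4 * c - 1)) + 16 * q2 * (b1 * b2 - t * N)).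
      by ring.
    by rewrite bt hq; ring.
  - transitivity (- (4 * b2) * (q0 * (4 * N) + q2 * (4 * c - 1))); first by ring.
    by rewrite hq; ring.
  - transitivity (- (4 * (c - t) - 1) * (q0 * (4 * N) + q2 * (4 * c - 1)) +
       16 * q0 * (b1 * b2 - t * N)); first by ring.
    by rewrite bt hq; ring.
exists M => //; apply/GammaP; split.
  rewrite det_mx33; case: hp => _ _ _ -> -> ->; rewrite !mxE /=.
  by apply: etrans hr; ring.
(* By [hq] the central entry is 1 - 4 q2 t. *)
elim/ord3P; elim/ord3P => //= _; rewrite !mxE /=; lia.
Qed.

Lemma double_coset_refl M : double_coset M M.
Proof.
exists 1%:M; first exact: Gamma_inf1.
by exists 1%:M; [exact: Gamma_inf1 | rewrite mul1mx mulmx1].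
Qed.

Lemma double_coset_sub u v M : Gamma_inf u -> Gamma_inf v ->
  (double_coset (u *m M *m v) `<=` double_coset M)%classic.
Proof.
move=> hu hv _ [u' hu' [v' hv' <-]].
exists (u' *m u); first exact: Gamma_infM.
by exists (v *m v'); [exact: Gamma_infM | rewrite !mulmxA].
Qed.

Lemma double_cosetE u v M : Gamma_inf u -> Gamma_inf v ->
  double_coset (u *m M *m v) = double_coset M.
Proof.
move=> hu hv; apply/seteqP; split; first exact: double_coset_sub.
have [u' hu' [uu' _]] := Gamma_infV hu; have [v' hv' [_ vv']] := Gamma_infV hv.
have {1}-> : M = u' *m (u *m M *m v) *m v'.
  by rewrite -!mulmxA vv' mulmx1 mulmxA uu' mul1mx.
exact: double_coset_sub.
Qed.

Lemma double_coset_plucker M M' A1 B1 C1 A2 B2 C2 :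
  plucker M A1 B1 C1 A2 B2 C2 -> double_coset M M' ->
  exists x y z, plucker M' A1 (B1 + x * A1) (C1 + 4 * (z * A1 + y * B1))
    A2 (B2 - y * A2) (C2 - 4 * (z - x * y) * A2 - 4 * x * B2).
Proof.
move=> hM [u hu [v /Gamma_infP[x [y [z ->]]] <-]].
by exists x, y, z; apply: plucker_right; apply: plucker_left.
Qed.

(** C2 is the value forced by the Plücker relation; the truncated quotient is exact when 2^k divides
    b1 b2. *)
Definition coset_plucker (k : nat) (b1 b2 c : nat) (M : 'M[int]_3) : Prop :=
  plucker M (2 ^+ k) b1 (4 * c%:Z - 1) (- 2 ^+ k) b2
    (4 * (c%:Z - (b1 * b2 %/ 2 ^ k)%N%:Z) - 1).

Lemma pow2z (k : nat) : 2 ^+ k = (2 ^ k)%N%:Z.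
Proof. by rewrite -natz natrX. Qed.

Lemma coset_plucker_exists (k b1 b2 c : nat) : (2 ^ k %| b1 * b2)%N ->
  exists2 M, Gamma M & coset_plucker k b1 b2 c M.
Proof.
move=> kb; apply: plucker_exists.
by rewrite pow2z -!PoszM divnK.
Qed.

(* Translating B1 and B2 modulo 2 ^ k changes C1 and C2 too, but not the sign. *)
Lemma splitting_double_coset (k b1 b2 c : nat) (M M' : 'M[int]_3) : (0 < k)%N ->
  (2 ^ k %| b1 * b2)%N -> coset_plucker k b1 b2 c M -> double_coset M M' ->
  splitting M' = (-1) ^+ (k * c) *
    (-1) ^+ ((k - logn 2 (gcdn (2 ^ k) b1)) * (b1 * b2 %/ 2 ^ k)).
Proof.
move=> k0 kb hM /(double_coset_plucker hM)[x [y [z hM']]].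
have [[a1 e1 c1] [a2 e2 c2]] := pluckerE hM'.
pose t := (b1 * b2 %/ 2 ^ k)%N.
pose c' : int := c%:Z + z * 2 ^+ k + y * b1.
(* The quotient by 2^k of the translated product (b1 + x 2^k)(b2 + y 2^k). *)
pose t' : int := t%:Z + x * b2 + y * b1 + x * y * 2 ^+ k.
have c1' : plC1 M' = 4 * c' - 1 by rewrite c1 /c'; ring.
have c2' : plC2 M' = 4 * (c' - t') - 1 by rewrite c2 /c' /t' -/t; ring.
rewrite (splitting_pow2 a1 a2 c1' c2') e1.
have -> : gcdn (2 ^ k) `|b1%:Z + x * 2 ^+ k| = gcdn (2 ^ k) b1.
  have := gcdzMDl x (2 ^ k)%N b1; rewrite addrC pow2z /gcdz !absz_nat => -[].
  by [].
have [j jk gj] := gcdn_pow2 k b1; rewrite gj pfactorK // -/t.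
(* The exponent changes by k y b1 + (k - j)(x b2 + y b1) modulo 2. Odd b1 forces j = 0, odd b2
   forces j = k, and in each case the change is even. *)
have b1j : odd b1 -> j = 0%N.
  move=> ob; have : (2 ^ j %| b1)%N by rewrite -gj dvdn_gcdr.
  by case: (j) => // i /dvdnP[q bq]; move: ob; rewrite bq expnS oddM oddM andbF.
have b2j : odd b2 -> j = k.
  move=> ob; move: kb; rewrite Gauss_dvdl ?coprimeXl ?coprime2n // => kb.
  by move: gj; rewrite (gcdn_idPl kb) => /(expnI (isT : (1 < 2)%N)).
have N2 : ~~ odd `|(2 ^+ k : int)%R| by rewrite pow2z absz_nat oddX /= orbF -lt0n k0.
rewrite -exprD -[LHS]signr_odd -[RHS]signr_odd; congr (_ ^+ _); congr nat_of_bool.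
rewrite !(oddD, oddM) oddB //.
have oddzD (a b : int) : odd `|(a + b)%R| = odd `|a| (+) odd `|b| by lia.
have -> : odd `|c'| = odd c (+) odd `|y| && odd b1.
  by rewrite /c' !oddzD !abszM !oddM (negPf N2) andbF addbF.
have -> : odd `|t'| = odd t (+) odd `|x| && odd b2 (+) odd `|y| && odd b1.
  by rewrite /t' !oddzD !abszM !oddM (negPf N2) andbF addbF.
case b1o : (odd b1); case b2o : (odd b2); rewrite ?andbF ?andbT ?addbF //.
- by move: k0; rewrite -(b2j b2o) (b1j b1o).
- by rewrite (b1j b1o); case: (odd k); case: (odd c); case: (odd t); case: (odd `|y|).
- by rewrite (b2j b2o) addbb.
Qed.


Lemma e2pi_double_coset (R : realType) (k b1 b2 c : nat) (m1 m2 : int) (M M' : 'M[int]_3) :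
  coset_plucker k b1 b2 c M -> double_coset M M' ->
  e2pi (m1%:~R * ((plB1 M')%:~R / (2 ^+ k)%:~R)
        + m2%:~R * ((plB2 M')%:~R / (- 2 ^+ k)%:~R) : R) =
  e2pi (m1%:~R * (b1%:R / 2 ^+ k) + m2%:~R * (b2%:R / - 2 ^+ k) : R).
Proof.
move=> hM /(double_coset_plucker hM)[x [y [z hM']]].
have [[a1 -> c1] [a2 -> c2]] := pluckerE hM'.
rewrite -[RHS](e2pi_addz _ (m1 * x - m2 * y)); congr e2pi.
rewrite !(rmorphB, rmorphD, rmorphM, rmorphN, rmorphXn) /= -!pmulrn.
by field; rewrite expf_neq0 // pnatr_eq0.
Qed.

Lemma coset_plucker_inj (k b1 b2 c b1' b2' c' : nat) (M M' : 'M[int]_3) :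
  (b1 < 2 ^ k)%N -> (b2 < 2 ^ k)%N -> (c < 2 ^ k)%N ->
  (b1' < 2 ^ k)%N -> (b2' < 2 ^ k)%N -> (c' < 2 ^ k)%N ->
  coset_plucker k b1 b2 c M -> coset_plucker k b1' b2' c' M' ->
  double_coset M M' -> [/\ b1 = b1', b2 = b2' & c = c'].
Proof.
move=> l1 l2 l3 l1' l2' l3' hM hM' /(double_coset_plucker hM)[x [y [z hM'']]].
have [[_ e1 c1] [_ e2 _]] := pluckerE hM''.
have [[_ e1' c1'] [_ e2' _]] := pluckerE hM'.
move: e1 e2 c1; rewrite e1' e2' c1' pow2z; move: (2 ^ k)%N l1 l2 l3 l1' l2' l3' => N.
move=> l1 l2 l3 l1' l2' l3' e1 e2 c1.
(* Residues in the range from 0 to N - 1 that differ by a multiple of N agree; z comes last because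
   C1 also moves with y. *)
have x0 : x = 0 by nia.
have y0 : y = 0 by nia.
have z0 : z = 0 by rewrite y0 in c1; nia.
by rewrite x0 in e1; rewrite y0 in e2; rewrite y0 z0 in c1; split; lia.
Qed.

Lemma Gamma_plucker_mod4 M A1 B1 C1 A2 B2 C2 : Gamma M ->
  plucker M A1 B1 C1 A2 B2 C2 -> (4 %| C1 + 1)%Z /\ (4 %| C2 + 1)%Z.
Proof.
move=> /GammaP[_ h] [_ h1 h2 _ _ h5].
have /dvdzP[a ha] := h 1 1 isT; have /dvdzP[b hb] := h 2 2 isT.
rewrite /= in ha hb; rewrite h1 in h5; split; apply/dvdzP.
  by exists (- b); lia.
exists (- (a * M 2 2 + b + M 1 2 * B1)).
have -> : C2 = - (M 1 1 * M 2 2 - M 1 2 * - (4 * B1)) by rewrite h5 opprK.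
have -> : M 1 1 = a * 4 + 1 by lia.
have -> : M 2 2 = b * 4 + 1 by lia.
ring.
Qed.

(** A right translation [v] reduces B1, B2 and c modulo 2^k; then C2 is forced and [plucker_inj]
    accounts for the left factor. *)
Lemma coset_plucker_surj (k : nat) (M : 'M[int]_3) :
  S_set (2 ^+ k) (- 2 ^+ k) M ->
  exists b1 b2 c : 'I_(2 ^ k), (2 ^ k %| b1 * b2)%N /\
    forall M', Gamma M' -> coset_plucker k b1 b2 c M' ->
      double_coset M' = double_coset M.
Proof.
move=> [GM a1 a2]; have := Gamma_plucker GM; rewrite a1 a2 pow2z.
set N := (2 ^ k)%N; have N0 : (0 < N)%N by rewrite expn_gt0.
set B1 := plB1 M; set B2 := plB2 M => hM.
have [/dvdzP[c0 hc0] _] := Gamma_plucker_mod4 GM hM.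
(* Reducing B2 by y moves c from c0 to c1, so z has to reduce c1. *)
pose y := - (B2 %/ N)%Z; pose c1 := c0 + y * B1.
pose v := unip (- (B1 %/ N)%Z) y (- (c1 %/ N)%Z).
have hv : Gamma_inf v by apply/Gamma_infP; do 3!eexists.
have inN (a : int) : (`|(a %% N)%Z| < N)%N by lia.
pose b1 := Ordinal (inN B1); pose b2 := Ordinal (inN B2); pose c := Ordinal (inN c1).
have GMv : Gamma (M *m v) by apply: GammaM => //; apply: Gamma_inf_sub.
have := plucker_right (- (B1 %/ N)%Z) y (- (c1 %/ N)%Z) hM.
set C2 := (X in plucker _ _ _ _ _ _ X).
have -> : B1 + - (B1 %/ N)%Z * N = b1 by rewrite /b1 /=; lia.
have -> : B2 - y * - N%:Z = b2 by rewrite /b2 /y /=; lia.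
have -> : plC1 M + 4 * (- (c1 %/ N)%Z * N + y * B1) = 4 * c%:Z - 1.
  rewrite (_ : plC1 M = c0 * 4 - 1); last by lia.
  have -> : c%:Z = c1 - (c1 %/ N)%Z * N by rewrite /c /=; lia.
  by rewrite /c1; ring.
move=> hMv; have [_ /dvdzP[c2 hc2]] := Gamma_plucker_mod4 GMv hMv.
(* The Plücker relation yields the divisibility of b1 b2 and identifies c - c2 as the quotient. *)
have hb : b1%:Z * b2 = (c%:Z - c2) * N.
  have := plucker_relation hMv; rewrite (_ : C2 = c2 * 4 - 1); last by lia.
  by lia.
have kb : (N %| b1 * b2)%N.
  have : (N %| b1%:Z * b2)%Z by rewrite hb dvdz_mull.
  by rewrite -PoszM.
exists b1, b2, c; split=> // M' GM' hM'.
have [u hu ->] : exists2 u, Gamma_inf u & M' = u *m (M *m v).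
  apply: (plucker_inj _ _ hMv); [by case: GMv | by case: GM' |].
  move: hM'; rewrite /coset_plucker pow2z -/N.
  have -> : (b1 * b2 %/ N)%N%:Z = c%:Z - c2.
    have -> : (b1 * b2 %/ N)%N%:Z = ((b1%:Z * b2) %/ N)%Z by rewrite -PoszM divz_nat.
    by rewrite hb mulzK // eqz_nat -lt0n.
  by rewrite (_ : C2 = 4 * (c%:Z - (c%:Z - c2)) - 1) //; lia.
by rewrite mulmxA double_cosetE.
Qed.

(** For triples with 2^k dividing b1 b2, [coset_plucker_exists] excludes the default 0. *)
Definition coset_rep (k : nat) (p : 'I_(2 ^ k) * 'I_(2 ^ k) * 'I_(2 ^ k)) : 'M[int]_3 :=
  xget 0 [set M | Gamma M /\ coset_plucker k p.1.1 p.1.2 p.2 M]%classic.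

Lemma coset_repP (k : nat) (p : 'I_(2 ^ k) * 'I_(2 ^ k) * 'I_(2 ^ k)) :
  (2 ^ k %| p.1.1 * p.1.2)%N ->
  Gamma (coset_rep p) /\ coset_plucker k p.1.1 p.1.2 p.2 (coset_rep p).
Proof.
move=> kp; have [M GM hM] := coset_plucker_exists p.2 kp.
by rewrite /coset_rep; case: xgetP => [_ -> //|/(_ M)]; case.
Qed.

Lemma double_cosets_bij (k : nat) :
  set_bij [set` fun p : 'I_(2 ^ k) * 'I_(2 ^ k) * 'I_(2 ^ k) => (2 ^ k %| p.1.1 * p.1.2)%N]
    (double_cosets (2 ^+ k) (- 2 ^+ k)) (fun p => double_coset (coset_rep p)).
Proof.
split.
- move=> p kp; have [GM hM] := coset_repP kp; exists (coset_rep p) => //.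
  by have [[a1 _ _] [a2 _ _]] := pluckerE hM; split.
- move=> p p' /set_mem kp /set_mem kp' e.
  have [GM hM] := coset_repP kp; have [GM' hM'] := coset_repP kp'.
  have := double_coset_refl (coset_rep p'); rewrite -e.
  move=> /(coset_plucker_inj _ _ _ _ _ _ hM hM')[]; rewrite ?ltn_ord // => e1 e2 e3.
  case: p p' e1 e2 e3 {kp kp' e GM hM GM' hM'} => [[a b] c] [[a' b'] c'] /=.
  by move=> /val_inj-> /val_inj-> /val_inj->.
- move=> X [M SM <-]; have [b1 [b2 [c [kb h]]]] := coset_plucker_surj SM.
  exists (b1, b2, c) => //=; have [GM' hM'] := @coset_repP k (b1, b2, c) kb.
  exact: h.
Qed.

(** * Assembling the sum over double cosets *)

Lemma sum_sign (R : nzRingType) (k n : nat) : ~~ odd n ->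
  \sum_(c < n) (-1) ^+ (k * c) = (~~ odd k)%:R * n%:R :> R.
Proof.
move=> en; have -> : n = (n./2).*2 by rewrite -[LHS]odd_double_half (negPf en).
elim: (n./2) => [|m IH]; first by rewrite big_ord0 mulr0.
rewrite doubleS !big_ord_recr IH /= -signr_odd -[X in _ + X]signr_odd.
rewrite !oddM /= odd_double /= andbF andbT -[_.+2]addn2 natrD mulrDr -addrA.
by case: (odd k); rewrite /= ?mul0r ?mul1r ?expr0 ?expr1 ?subrr.
Qed.

Lemma sum_double_cosetsE (V : nmodType) (k : nat) (F : set 'M[int]_3 -> V) :
  \sum_(X \in double_cosets (2 ^+ k) (- 2 ^+ k)) F X =
  \sum_(p : 'I_(2 ^ k) * 'I_(2 ^ k) * 'I_(2 ^ k) | (2 ^ k %| p.1.1 * p.1.2)%N)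
    F (double_coset (coset_rep p)).
Proof.
rewrite (reindex_fsbig _ _ _ _ (@double_cosets_bij k)).
rewrite -(bigfs _ (index_enum_uniq _)) // => p _.
by rewrite mem_index_enum.
Qed.

Theorem proposition25 (R : realType) (k : nat) (m1 m2 : int) (hk : (0 < k)%N) :
  Sigma R (2 ^+ k) (- 2 ^+ k) m1 m2 =
  2 ^+ k * (2 %| k)%N%:R *
  ((2 ^+ k %| m1)%Z%:R * 2 ^+ k
   + (2 ^+ k %| m2)%Z%:R * 2 ^+ k
   - (2 ^+ k.-1 %| m1)%Z%:R * 2 ^+ k.-1
   + \sum_(1 <= i < k)
       (-1) ^+ i * gauss_sum R (2 ^+ 2) m1 (2 ^ (k - i))
         * gauss_sum R (2 ^+ 2) m2 (2 ^ i)
   + \sum_(1 <= i < k)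
       (2 ^+ i.-1 %| m2)%Z%:R * 2 ^+ i.-1
         * gauss_sum R (2 ^+ 2) m1 (2 ^ (k - i))).
Proof.
rewrite /Sigma sum_double_cosetsE.
pose s (a b : nat) : R[i] :=
  (-1) ^+ ((k - logn 2 (gcdn (2 ^ k) a)) * (a * b %/ 2 ^ k))
  * e2pi (m1%:~R * (a%:R / 2 ^+ k) + m2%:~R * (b%:R / - 2 ^+ k) : R).
under eq_bigr => p kp.
  have [GM hM] := coset_repP kp.
  (* [Sigma] evaluates at an unknown element of the coset, so the summand is computed for an
     arbitrary one. *)
  have hX : double_coset (coset_rep p) (xget 0 (double_coset (coset_rep p))).
    by apply: xgetPex; exists (coset_rep p); exact: double_coset_refl.
  rewrite (splitting_double_coset hk kp hM hX) (e2pi_double_coset _ _ _ hM hX).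
  rewrite rmorphM !rmorphXn rmorphN1 /= -mulrA -/(s p.1.1 p.1.2).
  over.
(* The coordinate c enters neither the divisibility condition nor [s], so its sum factors out. *)
have -> : \sum_(p : 'I_(2 ^ k) * 'I_(2 ^ k) * 'I_(2 ^ k) | (2 ^ k %| p.1.1 * p.1.2)%N)
     (-1) ^+ (k * p.2) * s p.1.1 p.1.2 =
  (\sum_(c < 2 ^ k) (-1) ^+ (k * c)) *
  \sum_(a < 2 ^ k) \sum_(b < 2 ^ k | (2 ^ k %| a * b)%N) s a b.
  rewrite pair_big_dep /= mulr_sumr.
  rewrite (eq_bigr (fun q : 'I__ * 'I__ =>
    \sum_(c < 2 ^ k) (-1) ^+ (k * c) * s q.1 q.2)); last first.
    by move=> q _; rewrite mulr_suml.
  by rewrite pair_big /=; apply: eq_bigl => p; rewrite andbT.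
rewrite sum_sign; last by rewrite oddX orbF -lt0n.
have -> : (2 %| k)%N = ~~ odd k by rewrite dvdn2.
case: (boolP (odd k)) => ok /=; first by rewrite !mul0r mulr0 mul0r.
by rewrite sum_double_cosets // mul1r mulr1 natrX.
Qed.
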